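(* In the setting described in the context, suppose $\lim_{t\to\infty}\delta^2(t)\varepsilon(t)=\infty$, $\lim_{t\to\infty}\delta(t)=0$ and $\lim_{t\to\infty}\varepsilon(t)=\infty$. Let $x_t^*$ be the solution of VI$(\Omega,\Phi_{\delta\varepsilon})$ at time $t$. Then $\lim_{t\to\infty}x_t^*=x^*$, where $x^*$ is the least-norm solution of VI$(Q,F)$.
   Context: Let $f_i:\mathbb R^N\to\mathbb R$, $i=1,\dots,N$, $g(x)=Ax-b$ with $A\in\mathbb R^{n\times N}$, $b\in\mathbb R^n$, and $\Omega_i\subset\mathbb R$. Standing assumptions. (1) Each $f_i$ is twice continuously differentiable on $\mathbb R^N$ and convex in $x_i\in\mathbb R$ for every $x_{-i}\in\mathbb R^{N-1}$. (2) $F(x)=[\nabla_{x_1}f_1(x),\dots,\nabla_{x_N}f_N(x)]^T$ is monotone on $\mathbb R^N$: $(F(x)-F(y))^T(x-y)\ge0$. (3) Each $\Omega_i$ is nonempty, convex and compact, and with $\Omega=\Omega_1\times\cdots\times\Omega_N$ the set $Q=\{x\in\Omega: g(x)\le0\}$ (componentwise inequality) satisfies Slater's condition (there is $x_{\rm int}\in\Omega$ with $Ax_{\rm int}-b<0$ componentwise). For a convex set $K$ and a map $\Phi$, VI$(K,\Phi)$ asks for $x\in K$ with $(y-x)^T\Phi(x)\ge0$ for all $y\in K$. The penalty is $P(x)=\sum_{k=1}^nP_k(x)$, $P_k(x)=0$ if $g_k(x)\le0$ and $P_k(x)=(g_k(x))^2$ otherwise, where $g_k$ is the $k$-th component of $g$.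 $\delta,\varepsilon:[0,\infty)\to(0,\infty)$ are smooth with finite initial values, and at each time $t$, $\Phi_{\delta\varepsilon}(x)=F(x)+\delta(t)x+\varepsilon(t)\nabla_xP(x)$. Since $\Phi_{\delta\varepsilon}$ is strongly monotone at each $t$, VI$(\Omega,\Phi_{\delta\varepsilon})$ has a unique solution. ''Least-norm'' refers to the Euclidean norm; the least-norm solution of VI$(Q,F)$ is unique. *)

(* Defs.v *)
From mathcomp Require Import all_boot all_order all_algebra.
From mathcomp Require Import all_classical all_reals all_analysis.

Set Implicit Arguments.
Unset Strict Implicit.
Unset Printing Implicit Defensive.

Import Order.TTheory GRing.Theory Num.Theory.
Import numFieldNormedType.Exports.

Local Open Scope classical_set_scope.
Local Open Scope ring_scope.

(* Vectors are columns. The norm [`|x|] that the library puts on matrices is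
   the sup norm; it induces the usual topology of R^N, hence the usual limits
   and continuity, but "least-norm" must refer to [enorm]. *)
Definition dot (R : realType) (N : nat) (u v : 'cV[R]_N) : R :=
  (u^T *m v) 0 0.

Definition enorm (R : realType) (N : nat) (u : 'cV[R]_N) : R :=
  Num.sqrt (dot u u).

Definition partial (R : realType) (N : nat) (h : 'cV[R]_N -> R) (j : 'I_N) :
  'cV[R]_N -> R := 'D_(delta_mx j 0) h.

Definition grad (R : realType) (N : nat) (h : 'cV[R]_N -> R) (x : 'cV[R]_N) :
  'cV[R]_N := \col_j partial h j x.

(* ['D_v h x] is a junk value where [h] is not derivable, so existence of the
   partial derivatives is required separately. *)
Definition cont_diff (R : realType) (N : nat) (h : 'cV[R]_N -> R) : Prop :=
  forall j : 'I_N,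
    (forall x, derivable h x (delta_mx j 0)) /\ continuous (partial h j).

Definition twice_cont_diff (R : realType) (N : nat) (h : 'cV[R]_N -> R) : Prop :=
  cont_diff h /\ forall j : 'I_N, cont_diff (partial h j).

(* (s, x_{-i}) *)
Definition set_coord (R : realType) (N : nat) (x : 'cV[R]_N) (i : 'I_N) (s : R) :
  'cV[R]_N := \col_j (if j == i then s else x j 0).

Definition convex_in_coord (R : realType) (N : nat) (h : 'cV[R]_N -> R)
    (i : 'I_N) : Prop :=
  forall x : 'cV[R]_N,
    convex_function [set: R^o] (fun s : R^o => h (set_coord x i s)).

Definition pseudograd (R : realType) (N : nat) (f : 'I_N -> 'cV[R]_N -> R)
    (x : 'cV[R]_N) : 'cV[R]_N := \col_i partial (f i) i x.

Definition monotone_map (R : realType) (N : nat)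
    (Phi : 'cV[R]_N -> 'cV[R]_N) : Prop :=
  forall x y, 0 <= dot (Phi x - Phi y) (x - y).

Definition VI_sol (R : realType) (N : nat) (K : set 'cV[R]_N)
    (Phi : 'cV[R]_N -> 'cV[R]_N) (x : 'cV[R]_N) : Prop :=
  K x /\ forall y, K y -> 0 <= dot (y - x) (Phi x).

Definition least_norm_VI_sol (R : realType) (N : nat) (K : set 'cV[R]_N)
    (Phi : 'cV[R]_N -> 'cV[R]_N) (x : 'cV[R]_N) : Prop :=
  VI_sol K Phi x /\ forall y, VI_sol K Phi y -> enorm x <= enorm y.

Definition box (R : realType) (N : nat) (Omega : 'I_N -> set R) :
  set 'cV[R]_N := [set x | forall i, Omega i (x i 0)].

Definition gcon (R : realType) (n N : nat) (A : 'M[R]_(n, N)) (b : 'cV[R]_n)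
    (x : 'cV[R]_N) : 'cV[R]_n := A *m x - b.

Definition feasible (R : realType) (n N : nat) (Omega : 'I_N -> set R)
    (A : 'M[R]_(n, N)) (b : 'cV[R]_n) : set 'cV[R]_N :=
  [set x | box Omega x /\ forall k, gcon A b x k 0 <= 0].

Definition slater (R : realType) (n N : nat) (Omega : 'I_N -> set R)
    (A : 'M[R]_(n, N)) (b : 'cV[R]_n) : Prop :=
  exists2 x, box Omega x & forall k, gcon A b x k 0 < 0.

Definition penalty_k (R : realType) (n N : nat) (A : 'M[R]_(n, N))
    (b : 'cV[R]_n) (k : 'I_n) (x : 'cV[R]_N) : R :=
  if gcon A b x k 0 <= 0 then 0 else gcon A b x k 0 ^+ 2.

Definition penalty (R : realType) (n N : nat) (A : 'M[R]_(n, N))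
    (b : 'cV[R]_n) (x : 'cV[R]_N) : R := \sum_(k < n) penalty_k A b k x.

Definition Phi_de (R : realType) (n N : nat) (f : 'I_N -> 'cV[R]_N -> R)
    (A : 'M[R]_(n, N)) (b : 'cV[R]_n) (d e : R) (x : 'cV[R]_N) : 'cV[R]_N :=
  pseudograd f x + d *: x + e *: grad (penalty A b) x.

(* A function on [0, +oo[ is represented by a function on R whose values at
   negative arguments are irrelevant; smoothness on the closed half-line means,
   as usual, having a smooth extension to R. *)
Definition smooth_on_nneg (R : realType) (h : R -> R) : Prop :=
  exists2 g : R -> R,
    forall (k : nat) (s : R), derivable (derive1n k g) s 1 &
    forall t : R, 0 <= t -> g t = h t.

(* Main.v *)
Require Import Defs.
From mathcomp Require Import all_boot all_order all_algebra.
From mathcomp Require Import all_classical all_reals all_analysis.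
From mathcomp Require Import ring lra.
Import Order.TTheory GRing.Theory Num.Theory.
Import numFieldNormedType.Exports.
Local Open Scope classical_set_scope.
Local Open Scope ring_scope.

(** Write [F] for the pseudogradient, [Q] for the feasible set, [P] for the
    penalty and [x_t] for the solution at time [t].

    Testing the variational inequality of [x_t] with a feasible [y], the
    subgradient inequality of the convex function [P], which vanishes on [Q],
    gives ([penalized_VI_estimate])
<<
      eps P(x_t) <= (y - x_t).F(x_t) + delta (y - x_t).x_t.
>>
    Since [delta -> 0] and [P >= 0], every cluster point [p] of [x_t] satisfies
    [(y - p).F(p) >= 0] for all feasible [y].

    The terms at [y = xstar] must be compared at the finer scale [delta]. By
    monotonicity [F(x_t)] may be replaced by [F(xstar)], but
    [(xstar - x_t).F(xstar)] need not be nonpositive, because [x_t] may violate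
    the constraints. Slater's condition bounds it by [C s], with
    [s = sqrt P(x_t)] ([slater_error_bound]), whence
<<
      eps s^2 - C s <= delta (xstar - x_t).x_t.
>>
    The right-hand side is at most [delta |xstar|^2], so [s -> 0] and [p] is
    feasible ([violation_le]); the left-hand side is at least [- C^2 / (4 eps)],
    so [(xstar - x_t).x_t >= - C^2 / (4 delta eps) -> 0]
    ([regularization_lower_bound]) and [(xstar - p).p >= 0]. As [p] solves
    VI(Q, F), also [|xstar| <= |p|], so that
<<
      |xstar - p|^2 = |xstar|^2 - |p|^2 - 2 (xstar - p).p <= 0
>>
    and [p = xstar]. The box is compact, so a single cluster point means
    convergence ([compact_cluster_cvg]). *)

(** * The Euclidean inner product *)

Section dot.
Context {R : realType} {N : nat}.
Implicit Types u v w : 'cV[R]_N.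

Lemma dotE u v : dot u v = \sum_i u i 0 * v i 0.
Proof. by rewrite /dot mxE; apply: eq_bigr => i _; rewrite mxE. Qed.

Lemma dotC u v : dot u v = dot v u.
Proof. by rewrite !dotE; apply: eq_bigr => i _; rewrite mulrC. Qed.

Lemma dotDl u v w : dot (u + v) w = dot u w + dot v w.
Proof. by rewrite /dot linearD mulmxDl mxE. Qed.

Lemma dotDr u v w : dot w (u + v) = dot w u + dot w v.
Proof. by rewrite dotC dotDl !(dotC w). Qed.

Lemma dotZl a u w : dot (a *: u) w = a * dot u w.
Proof. by rewrite /dot linearZ -scalemxAl mxE. Qed.

Lemma dotZr a u w : dot w (a *: u) = a * dot w u.
Proof. by rewrite dotC dotZl dotC. Qed.

Lemma dotNl u w : dot (- u) w = - dot u w.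
Proof. by rewrite -scaleN1r dotZl mulN1r. Qed.

Lemma dotBl u v w : dot (u - v) w = dot u w - dot v w.
Proof. by rewrite dotDl dotNl. Qed.

Lemma dotBr u v w : dot w (u - v) = dot w u - dot w v.
Proof. by rewrite dotC dotBl !(dotC w). Qed.

Lemma dot_ge0 u : 0 <= dot u u.
Proof. by rewrite dotE sumr_ge0// => i _; rewrite -expr2 sqr_ge0. Qed.

Lemma dot_le0_eq0 u : dot u u <= 0 -> u = 0.
Proof.
move=> u0; have /eqP : dot u u = 0 by apply/eqP; rewrite eq_le u0 dot_ge0.
rewrite dotE psumr_eq0 => [/allP h|i _]; last by rewrite -expr2 sqr_ge0.
apply/colP => i; rewrite mxE; apply/eqP.
by have := h i (mem_index_enum _); rewrite /= mulf_eq0 orbb.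
Qed.

(** Completing the square: [v |-> (u - v).v] is maximal at [v = u / 2]. The
    cruder constant 1 instead of 1/4 is enough to control the regularization
    term uniformly in [v]. *)
Lemma dotB_le u v : dot (u - v) v <= dot u u.
Proof.
have := dot_ge0 (u - v); have := dot_ge0 u; have := dot_ge0 v.
rewrite !dotBl !dotBr (dotC v u); lra.
Qed.

Lemma enorm_le u v : enorm u <= enorm v -> dot u u <= dot v v.
Proof. by rewrite /enorm ler_sqrt ?dot_ge0. Qed.

Lemma coord_subr_continuous u i : continuous (fun x : 'cV[R]_N => (u - x) i 0).
Proof.
have -> : (fun x : 'cV[R]_N => (u - x) i 0) = (fun x => u i 0 - x i 0).
  by apply/funext => x; rewrite !mxE.
move=> x; have h : {for x, continuous (fun x : 'cV[R]_N => x i 0)}.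
  exact: coord_continuous.
by apply: (continuousB _ h); exact: cst_continuous.
Qed.

Lemma dot_continuous (G H : 'cV[R]_N -> 'cV[R]_N) :
  (forall i, continuous (fun x => G x i 0)) ->
  (forall i, continuous (fun x => H x i 0)) ->
  continuous (fun x => dot (G x) (H x) : R).
Proof.
move=> cG cH.
have -> : (fun x => dot (G x) (H x)) =
    (fun x => \sum_i G x i 0 * H x i 0).
  by apply/funext => x; rewrite dotE.
apply: continuous_big => [|i _ x]; first exact: add_continuous.
exact: (continuousM (cG i x) (cH i x)).
Qed.

End dot.

(** * Compactness and cluster points *)

Section cluster_points.

(** If the filter missed a neighbourhood [U] of [p], its trace on the complement
    of [U] would be proper and have a cluster point in [K]; this would be a
    cluster point of [F] as well, hence [p], although [U] is avoided. *)
Lemma compact_cluster_cvg (T : topologicalType) (K : set T) (F : set_system T)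
    (p : T) : Filter F -> compact K -> F K ->
  (forall q, K q -> cluster F q -> q = p) -> F --> p.
Proof.
move=> FF cK FK clF U pU; apply: contrapT => nFU.
pose G := within (~` U) F.
have GF : ProperFilter G.
  apply: Build_ProperFilter_ex => B GB; apply: contrapT => nB; apply: nFU; move: GB.
  rewrite /G /within /=; apply: filterS => x nUB.
  by apply: contrapT => /nUB Bx; apply: nB; exists x.
have [|q [Kq clq]] := cK G GF.
  by move: FK; apply: filterS => x Kx _.
have qp : q = p.
  apply: clF => // B C FB qC; apply: clq => //.
  by move: FB; apply: filterS => x Bx _.
have GU : G (~` U) by rewrite /G /within; apply: nearW.
by rewrite qp in clq; have [x []] := clq _ _ GU pU.
Qed.

(** Cluster points inherit asymptotic inequalities, although limits along the
    filter need not exist. *)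
Lemma cluster_ge0 (R : realType) (T : topologicalType) (F : set_system T)
    (h : T -> R) (p : T) :
  cluster F p -> {for p, continuous h} ->
  (forall e, 0 < e -> \forall x \near F, - e <= h x) -> 0 <= h p.
Proof.
move=> clp ch hF; rewrite leNgt; apply/negP => hp0.
have hp2 : 0 < - h p / 2 by rewrite divr_gt0// oppr_gt0.
have : \forall x \near p, h x < h p / 2 by apply: (cvgr_lt _ ch); lra.
move=> /(clp _ _ (hF _ hp2)) [x [/= h1 h2]]; lra.
Qed.

End cluster_points.

Lemma trmx_continuous (T : topologicalType) m n :
  continuous (@trmx T m n).
Proof.
move=> M U [P PM PU]; exists (fun i j => P j i) => [i j|X PX].
  by have := PM j i; rewrite mxE.
by apply: PU => i j; rewrite mxE.
Qed.

Lemma box_compact (R : realType) N (Omega : 'I_N -> set R) :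
  (forall i, compact (Omega i)) -> compact (box Omega).
Proof.
move=> cO.
have -> : box Omega = trmx @` [set v : 'rV[R]_N | forall i, Omega i (v 0 i)].
  apply/seteqP; split => [x Ox|_ [v Ov <-] i]; last by rewrite mxE.
  by exists x^T; rewrite ?trmxK// => i; rewrite mxE.
apply: continuous_compact; last exact: rV_compact.
by apply: continuous_subspaceT; exact: trmx_continuous.
Qed.

Lemma box_convex (R : realType) N (Omega : 'I_N -> set R) (x y : 'cV[R]_N) l :
  (forall i, convex_set (Omega i : set R^o)) ->
  box Omega x -> box Omega y -> 0 <= l <= 1 ->
  box Omega (x + l *: (y - x)).
Proof.
move=> cO Ox Oy /andP[l0 l1] i.
have := cO i (y i 0) (x i 0) (Itv01 l0 l1).
rewrite !inE => /(_ (Oy i) (Ox i)).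
have -> : (x + l *: (y - x)) i 0 = l * y i 0 + (1 - l) * x i 0.
  by rewrite !mxE; ring.
by [].
Qed.

(** * The penalty function *)

(** The penalty is only piecewise polynomial, so its partial derivatives are
    obtained from a first-order expansion with a quadratic remainder. *)
Lemma derive_quadratic_remainder (R : realType) (V : normedModType R)
    (h : V -> R) (x v : V) (L C : R) :
  (forall t, `|h (t *: v + x) - h x - t * L| <= C * t ^+ 2) ->
  'D_v h x = L.
Proof.
move=> hC; apply: cvg_lim => //.
have C0 : 0 <= C by have := le_trans (normr_ge0 _) (hC 1); rewrite expr1n mulr1.
apply/cvgrPdist_le => e e0; near=> t.
have t0 : 0 < `|t| by rewrite normr_gt0; near: t; exact: nbhs_dnbhs_neq.
have tC : `|t| <= e / (C + 1).
  by near: t; apply: dnbhs0_le; rewrite divr_gt0// ltr_wpDl.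
rewrite -(ler_pM2l t0) -normrM /=.
have -> : t * (L - t^-1 *: (h (t *: v + x) - h x)) =
    - (h (t *: v + x) - h x - t * L).
  rewrite /GRing.scale/=; field; by rewrite -normr_gt0.
rewrite normrN (le_trans (hC t))// -[t ^+ 2]real_normK ?num_real// expr2 mulrCA.
apply: ler_wpM2l => //.
move: tC; rewrite ler_pdivlMr ?ltr_wpDl// => /(le_trans _); apply.
by rewrite mulrC ler_wpM2l// lerDl.
Unshelve. all: by end_near. Qed.

Section penalty.
Context {R : realType}.
Implicit Types c d u : R.

(** The square of the positive part, in the form in which it occurs in
    [penalty_k]. *)
Definition pos_sq c : R := if c <= 0 then 0 else c ^+ 2.

Lemma pos_sq_ge0 c : 0 <= pos_sq c.
Proof. by rewrite /pos_sq; case: ifP => // _; rewrite sqr_ge0. Qed.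

Lemma pos_sq_remainder c u :
  `|pos_sq (c + u) - pos_sq c - 2 * Num.max c 0 * u| <= u ^+ 2.
Proof.
rewrite /pos_sq ler_norml; have [c0|c0] := leP c 0; have [cu|cu] := leP (c + u) 0.
- by apply/andP; split; nra.
- by apply/andP; split; nra.
- by apply/andP; split; nra.
- by apply/andP; split; nra.
Qed.

Lemma pos_sq_subgradient c d : 2 * Num.max c 0 * (d - c) <= pos_sq d - pos_sq c.
Proof.
rewrite /pos_sq; case: (leP c 0) => c0; case: (leP d 0) => d0; try nra.
by have := sqr_ge0 (d - c); rewrite !expr2; nra.
Qed.

Section gradient.
Context {n N : nat} (A : 'M[R]_(n, N)) (b : 'cV[R]_n).
Implicit Types x y : 'cV[R]_N.

Lemma penaltyE x : penalty A b x = \sum_k pos_sq (gcon A b x k 0).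
Proof. by []. Qed.

Lemma gcon_shift x v k : gcon A b (v + x) k 0 = gcon A b x k 0 + (A *m v) k 0.
Proof. by rewrite /gcon mulmxDr !mxE; ring. Qed.

Lemma mulmx_scale_delta (t : R) j k :
  (A *m (t *: delta_mx j 0 : 'cV_N)) k 0 = t * A k j.
Proof. by rewrite -scalemxAr -colE !mxE. Qed.

Lemma partial_penalty j x : partial (penalty A b) j x =
  \sum_k 2 * Num.max (gcon A b x k 0) 0 * A k j.
Proof.
apply: (@derive_quadratic_remainder _ _ _ _ _ _ (\sum_k A k j ^+ 2)) => t.
rewrite !penaltyE mulr_suml mulr_sumr -!sumrB (le_trans (ler_norm_sum _ _ _))//.
apply: ler_sum => k _; rewrite gcon_shift mulmx_scale_delta.
apply: le_trans (_ : _ <= (t * A k j) ^+ 2) _; last by rewrite exprMn mulrC.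
by apply: le_trans (pos_sq_remainder _ _); rewrite le_eqVlt; apply/orP; left;
  apply/eqP; congr (`| _ |); ring.
Qed.

(** The subgradient inequalities of the convex functions [pos_sq], composed with
    the affine constraints and added up. *)
Lemma penalty_subgradient x y :
  dot (y - x) (grad (penalty A b) x) <= penalty A b y - penalty A b x.
Proof.
have -> : dot (y - x) (grad (penalty A b) x) =
    \sum_k 2 * Num.max (gcon A b x k 0) 0 * (A *m (y - x)) k 0.
  rewrite dotE; under eq_bigr do rewrite [grad _ _ _ _]mxE partial_penalty mulr_sumr.
  rewrite exchange_big; apply: eq_bigr => k _.
  rewrite [(A *m (y - x)) k 0]mxE mulr_sumr.
  by apply: eq_bigr => j _; ring.
rewrite !penaltyE -sumrB; apply: ler_sum => k _.
rewrite (le_trans _ (pos_sq_subgradient _ _))// le_eqVlt; apply/orP; left.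
by apply/eqP; congr (_ * _); rewrite /gcon mulmxBr !mxE; ring.
Qed.

Lemma gcon_continuous k : continuous (fun x => gcon A b x k 0).
Proof.
have -> : (fun x => gcon A b x k 0) =
    (fun x => dot ((row k A)^T : 'cV_N) x - b k 0).
  apply/funext => x; rewrite /gcon !mxE dotE; congr (_ - _).
  by apply: eq_bigr => i _; rewrite !mxE.
move=> x; apply: continuousB; last exact: cst_continuous.
apply: dot_continuous => i; last exact: coord_continuous.
exact: cst_continuous.
Qed.

Lemma penalty_ge0 x : 0 <= penalty A b x.
Proof. by rewrite penaltyE sumr_ge0// => k _; exact: pos_sq_ge0. Qed.

Lemma penalty_feasible x : (forall k, gcon A b x k 0 <= 0) -> penalty A b x = 0.
Proof. by move=> gx; rewrite /penalty big1// => k _; rewrite /penalty_k gx. Qed.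

Lemma gcon_le_sqrt_penalty x k : gcon A b x k 0 <= Num.sqrt (penalty A b x).
Proof.
have [g0|g0] := leP (gcon A b x k 0) 0; first exact: le_trans g0 (sqrtr_ge0 _).
rewrite -[leLHS](ger0_norm (ltW g0)) -sqrtr_sqr ler_wsqrtr//.
rewrite penaltyE (bigD1 k)//= {1}/pos_sq (lt_geF g0) lerDl.
by rewrite sumr_ge0// => i _; exact: pos_sq_ge0.
Qed.

End gradient.

End penalty.

(** * Estimates at a fixed time *)

Section estimates.
Context {R : realType} {n N : nat} {A : 'M[R]_(n, N)} {b : 'cV[R]_n}
  {Omega : 'I_N -> set R}.
Implicit Types x y v : 'cV[R]_N.

Lemma slater_margin : slater Omega A b ->
  exists x s, [/\ box Omega x, 0 < s & forall k, gcon A b x k 0 <= - s].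
Proof.
move=> [x Ox gx]; exists x, (\big[Num.min/1]_k - gcon A b x k 0); split => //.
  by apply/bigmin_gtP; split => // k _; rewrite oppr_gt0.
by move=> k; rewrite lerNr; exact: bigmin_le.
Qed.

(** Moving [x] towards a Slater point [x0] with margin [s] by the fraction
    [l = r / (r + s)], where [r = sqrt P(x)] bounds every constraint value at
    [x], yields a feasible point: [(1 - l) r - l s = 0]. The inequality at that
    point gives [(z - x).v <= l (x0 - x).v], and [l <= r / s]. *)
Lemma slater_error_bound v z :
  (forall i, convex_set (Omega i : set R^o)) ->
  (forall i, compact (Omega i)) ->
  slater Omega A b ->
  (forall y, feasible Omega A b y -> 0 <= dot (y - z) v) ->
  exists C, forall x, box Omega x ->
    dot (z - x) v <= C * Num.sqrt (penalty A b x).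
Proof.
move=> Oconv Ocomp /slater_margin[x0 [s [Ox0 s0 gx0]]] zv.
(* The linear form (x0 - x).v is bounded on the compact box. *)
have [D D0 hD] : exists2 D, 0 <= D & forall x, box Omega x -> dot (x0 - x) v <= D.
  have [||x1 _ hx1] := @compact_EVT_max _ R (fun x => dot (x0 - x) v) _ _
    (box_compact _ _ _ Ocomp).
  - by exists x0.
  - apply: continuous_subspaceT.
    apply: dot_continuous => i; last exact: cst_continuous.
    exact: coord_subr_continuous.
  exists (dot (x0 - x1) v) => [|x Ox]; last by apply: hx1; rewrite inE.
  by have := hx1 x0; rewrite inE subrr {1}dotE big1 => [|i _];
    [apply|rewrite mxE mul0r].
exists (D / s) => x Ox.
set r := Num.sqrt (penalty A b x); have r0 : 0 <= r by exact: sqrtr_ge0.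
have rs0 : 0 < r + s by rewrite ltr_wpDl.
pose l := r / (r + s); have l0 : 0 <= l by rewrite divr_ge0// ltW.
have l1 : l <= 1 by rewrite ler_pdivrMr// mul1r lerDl ltW.
have Qq : feasible Omega A b (x + l *: (x0 - x)).
  split=> [|k]; first by apply: box_convex; rewrite ?l0.
  have -> : gcon A b (x + l *: (x0 - x)) k 0 =
      (1 - l) * gcon A b x k 0 + l * gcon A b x0 k 0.
    by rewrite /gcon mulmxDr -scalemxAr mulmxBr !mxE; ring.
  have := gcon_le_sqrt_penalty A b x k; rewrite -/r => gr.
  have -> : 0 = (1 - l) * r + l * (- s) by rewrite /l; field; rewrite gt_eqF.
  by apply: lerD; apply: ler_wpM2l; rewrite ?subr_ge0.
have := zv _ Qq; rewrite addrAC dotDl dotZl -(opprB z x) dotNl addrC subr_ge0.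
move=> /le_trans; apply; apply: le_trans (_ : _ <= l * D) _.
  by rewrite ler_wpM2l// hD.
have -> : D / s * r = r / s * D by ring.
rewrite ler_wpM2r// /l ler_wpM2l//.
by rewrite lef_pV2 ?posrE// lerDr.
Qed.

(** The gradient of the penalty at [x] points away from every feasible [y]:
    [(y - x).grad P(x) <= P(y) - P(x) = - P(x)]. *)
Lemma penalized_VI_estimate (f : 'I_N -> 'cV[R]_N -> R) d e x y : 0 <= e ->
  VI_sol (box Omega) (Phi_de f A b d e) x -> feasible Omega A b y ->
  e * penalty A b x <= dot (y - x) (pseudograd f x) + d * dot (y - x) x.
Proof.
move=> e0 [Ox hx] [Oy gy]; have := hx y Oy; rewrite /Phi_de !dotDr !dotZr.
have := penalty_subgradient A b x y; rewrite penalty_feasible// sub0r.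
move=> /(ler_wpM2l e0); rewrite mulrN; lra.
Qed.

End estimates.

(** * Scalar asymptotics

    Both lemmas exploit [e s^2 - C s <= d Z], where [s] measures the constraint
    violation and [Z = (xstar - x).x]. *)

Section scalar_estimates.
Context {R : realType}.
Implicit Types B C d e s Z tau : R.

(** If [s > tau], then [e s^2 >= e tau s >= (C + B / tau + 1) s > C s + B], which
    exceeds the upper bound [C s + d Z]. *)
Lemma violation_le B C d e s Z tau : 0 < tau -> 0 < d -> 0 < e ->
  e * s ^+ 2 - C * s <= d * Z -> 0 <= B -> Z <= B -> d <= 1 ->
  (C + B / tau + 1) / tau <= e -> s <= tau.
Proof.
move=> tau0 d0 e0 balance B0 ZB d1 e1; rewrite leNgt; apply/negP => taus.
have s0 : 0 < s by exact: lt_trans taus.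
have dB : d * Z <= B.
  by rewrite (le_trans (ler_wpM2l (ltW d0) ZB))// ler_piMl.
have : (C + B / tau + 1) * s <= e * s ^+ 2.
  rewrite expr2 mulrA ler_wpM2r ?(ltW s0)//.
  move: e1; rewrite ler_pdivrMr// => /le_trans; apply.
  by rewrite ler_wpM2l ?(ltW e0)// ltW.
have : B <= B / tau * s by rewrite mulrAC ler_pdivlMr// ler_wpM2l// ltW.
move: balance; lra.
Qed.

(** Minimizing [e s^2 - C s] over [s] gives [d Z >= - C^2 / (4 e)]. *)
Lemma regularization_lower_bound C d e s Z tau : 0 < d -> 0 < e ->
  e * s ^+ 2 - C * s <= d * Z -> C ^+ 2 <= tau * (d * e) -> - tau <= Z.
Proof.
move=> d0 e0 balance C2; rewrite leNgt; apply/negP => Ztau.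
have : 4 * e * (e * s ^+ 2 - C * s) >= - C ^+ 2.
  by have := sqr_ge0 (2 * e * s - C); rewrite !expr2; lra.
have dZ : d * Z < d * (- tau) by rewrite ltr_pM2l.
have := le_lt_trans balance dZ; rewrite -(ltr_pM2l e0).
have := sqr_ge0 C; lra.
Qed.

End scalar_estimates.

(** * Convergence *)

Theorem lemma6 (R : realType) (n N : nat)
  (f : 'I_N -> 'cV[R]_N -> R)
  (A : 'M[R]_(n, N)) (b : 'cV[R]_n)
  (Omega : 'I_N -> set R)
  (delta eps : R -> R)
  (xt : R -> 'cV[R]_N) (xstar : 'cV[R]_N)
  (f_C2 : forall i, twice_cont_diff (f i))
  (f_convex : forall i, convex_in_coord (f i) i)
  (F_monotone : monotone_map (pseudograd f))
  (Omega_nonempty : forall i, Omega i !=set0)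
  (Omega_convex : forall i, convex_set (Omega i : set R^o))
  (Omega_compact : forall i, compact (Omega i))
  (Q_slater : slater Omega A b)
  (delta_gt0 : forall t, 0 <= t -> 0 < delta t)
  (eps_gt0 : forall t, 0 <= t -> 0 < eps t)
  (delta_smooth : smooth_on_nneg delta)
  (eps_smooth : smooth_on_nneg eps)
  (delta2_eps_lim : delta t ^+ 2 * eps t @[t --> +oo] --> +oo)
  (delta_lim : delta t @[t --> +oo] --> 0)
  (eps_lim : eps t @[t --> +oo] --> +oo)
  (xt_sol : forall t, 0 <= t ->
     VI_sol (box Omega) (Phi_de f A b (delta t) (eps t)) (xt t))
  (xstar_sol :
     least_norm_VI_sol (feasible Omega A b) (pseudograd f) xstar) :
  xt t @[t --> +oo] --> xstar.
Proof.
pose F := pseudograd f; pose P := penalty A b; pose B := dot xstar xstar.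
have B0 : 0 <= B by exact: dot_ge0.
have [[Qxstar VIxstar] least] := xstar_sol.
have [C hC] := slater_error_bound (F xstar) xstar Omega_convex Omega_compact
  Q_slater VIxstar.
have near0 : \forall t \near +oo, (0 : R) <= t by exact: nbhs_pinfty_ge.
have delta_small tau : 0 < tau -> \forall t \near +oo, delta t <= tau.
  move=> tau0; near=> t; apply: le_trans (ler_norm _) _.
  by near: t; exact: cvgr0_norm_le.
pose s t := Num.sqrt (P (xt t)).
(* Monotonicity moves F from xt t to xstar, where the error bound applies. *)
have key t : 0 <= t ->
    eps t * s t ^+ 2 - C * s t <= delta t * dot (xstar - xt t) (xt t).
  rewrite /s sqr_sqrtr ?penalty_ge0// => t0; have [Oxt _] := xt_sol t t0.
  have := penalized_VI_estimate _ _ _ _ _ (ltW (eps_gt0 t t0)) (xt_sol t t0) Qxstar.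
  have := F_monotone xstar (xt t); have := hC _ Oxt.
  rewrite dotBl (dotC (F xstar)) (dotC (pseudograd f (xt t))) -/F -/P; lra.
have xt_box : \forall t \near +oo, box Omega (xt t).
  by apply: filterS near0 => t t0; have [] := xt_sol t t0.
apply: (compact_cluster_cvg _ (box Omega)) => //; first exact: box_compact.
move=> p Op clp.
(* Continuous inequalities that hold asymptotically along xt hold at p. *)
have asympt h : continuous (h : 'cV[R]_N -> R) ->
    (forall tau, 0 < tau -> \forall t \near +oo, - tau <= h (xt t)) -> 0 <= h p.
  by move=> ch hh; apply: (cluster_ge0 _ _ _ _ _ clp) => //; exact: ch.
have gp k : gcon A b p k 0 <= 0.
  rewrite -oppr_ge0; apply: (asympt (fun x => - gcon A b x k 0)) => [|tau tau0].
    by move=> x; apply: continuousN; exact: gcon_continuous.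
  near=> t; rewrite lerN2 (le_trans (gcon_le_sqrt_penalty _ _ _ _))//.
  have t0 : 0 <= t by near: t.
  have d1 : delta t <= 1 by near: t; exact: delta_small.
  have e1 : (C + B / tau + 1) / tau <= eps t.
    by near: t; move/cvgryPge: eps_lim; apply.
  apply: violation_le (key t t0) B0 _ d1 e1; rewrite ?delta_gt0 ?eps_gt0//.
  exact: dotB_le.
have VIp : VI_sol (feasible Omega A b) F p.
  split=> // y Qy; apply: (asympt (fun x => dot (y - x) (F x))).
    apply: dot_continuous; first exact: coord_subr_continuous.
    move=> i; have -> : (fun x => F x i 0) = partial (f i) i.
      by apply/funext => x; rewrite mxE.
    exact: ((f_C2 i).1 i).2.
  move=> tau tau0; near=> t.
  have t0 : 0 <= t by near: t.
  have := penalized_VI_estimate _ _ _ _ _ (ltW (eps_gt0 t t0)) (xt_sol t t0) Qy.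
  have := ler_wpM2l (ltW (delta_gt0 t t0)) (dotB_le y (xt t)).
  have := mulr_ge0 (ltW (eps_gt0 t t0)) (penalty_ge0 A b (xt t)).
  have : delta t * dot y y <= tau.
    have : delta t <= tau / (dot y y + 1).
      by near: t; apply: delta_small; rewrite divr_gt0// ltr_wpDl// dot_ge0.
    rewrite ler_pdivlMr ?ltr_wpDl ?dot_ge0//; apply: le_trans.
    by rewrite ler_wpM2l ?lerDl// ltW// delta_gt0.
  rewrite -/F; lra.
have xp : 0 <= dot (xstar - p) p.
  apply: (asympt (fun x => dot (xstar - x) x)) => [|tau tau0].
    apply: dot_continuous => i; last exact: coord_continuous.
    exact: coord_subr_continuous.
  near=> t; have t0 : 0 <= t by near: t.
  have d0 := delta_gt0 t t0; have e0 := eps_gt0 t t0.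
  have d1 : delta t <= 1 by near: t; exact: delta_small.
  (* Once delta <= 1, delta * eps dominates delta ^ 2 * eps. *)
  have : C ^+ 2 <= tau * (delta t * eps t).
    rewrite -ler_pdivrMl// mulrC.
    apply: le_trans (_ : _ <= delta t ^+ 2 * eps t) _.
      by near: t; move/cvgryPge: delta2_eps_lim; apply.
    by rewrite ler_wpM2r ?(ltW e0)// expr2 ler_piMl ?(ltW d0).
  exact: regularization_lower_bound (key t t0).
have := enorm_le _ _ (least p VIp) => np.
apply/eqP; rewrite eq_sym -subr_eq0; apply/eqP/dot_le0_eq0.
move: xp np; rewrite !dotBl !dotBr (dotC p xstar); lra.
Unshelve. all: by end_near. Qed.
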